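(* Let $f:\mathbb{R}^d\to\mathbb{R}$ be a (differentiable) $\mu$-strongly convex function, $\mu>0$, with minimizer $x^*$. Let $m,q\ge 0$ and $n,p>0$, and consider the system $$\dot{X}_t=-m\nabla f(X_t)-n(X_t-V_t),\qquad \dot{V}_t=-p\nabla f(X_t)-q(V_t-X_t),\qquad t\ge 0.$$ (a) Suppose that $n=q\le p\mu$. Then the trajectories $X_t$ and $V_t$ are globally asymptotically stable for this system, satisfying $$\varepsilon(t)\le e^{-qt}\varepsilon(0)\quad\text{with}\quad\varepsilon(t)=f(X_t)-f(x^* )+\frac{q}{2p}\|V_t-x^*\|^2 .$$ (b) Suppose that $n\le 2q\le 2p\mu$ and $m\le 2p$. Then the trajectories $X_t$ and $V_t$ are globally asymptotically stable for this system, satisfying $$\varepsilon(t)\le e^{-nt}\varepsilon(0)\quad\text{with}\quad\varepsilon(t)=f(X_t)-f(x^* )-\frac{n-q}{2p}\|X_t-x^*\|^2+\frac{n}{2p}\|V_t-x^*\|^2 .$$ Consequently, both $X_t$ and $V_t$ converge to $x^*$ as $t\to\infty$.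
   Context: Dots denote time derivatives and $\|\cdot\|$ is the Euclidean norm. ''Globally asymptotically stable'' refers to the equilibrium $(x^*,x^* )$ of the system: it is Lyapunov stable and every solution $(X_t,V_t)$ converges to it as $t\to\infty$. *)

(* Defs.v *)
From HB Require Import structures.
From mathcomp Require Import all_boot all_order all_algebra.
From mathcomp Require Import all_classical all_reals all_analysis.

Set Implicit Arguments.
Unset Strict Implicit.
Unset Printing Implicit Defensive.

Import Order.TTheory GRing.Theory Num.Theory.
Import numFieldNormedType.Exports.

Local Open Scope classical_set_scope.
Local Open Scope ring_scope.

(* The library norm `|u| on 'rV[R]_d is the max norm (same topology), so the
   Euclidean norm is defined separately. *)
Definition enorm (R : realType) (d : nat) (u : 'rV[R]_d) : R :=
  Num.sqrt (\sum_(i < d) u 0 i ^+ 2).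

Definition gradient (R : realType) (d : nat) (f : 'rV[R]_d -> R)
    (x : 'rV[R]_d) : 'rV[R]_d :=
  \row_(i < d) 'D_(delta_mx 0 i) f x.

Definition strongly_convex (R : realType) (d : nat) (mu : R)
    (f : 'rV[R]_d -> R) : Prop :=
  forall (x y : 'rV[R]_d) (t : R), 0 <= t -> t <= 1 ->
    f (t *: x + (1 - t) *: y) <=
      t * f x + (1 - t) * f y - mu / 2 * t * (1 - t) * enorm (x - y) ^+ 2.

Definition minimizer (R : realType) (d : nat) (f : 'rV[R]_d -> R)
    (x : 'rV[R]_d) : Prop :=
  forall y : 'rV[R]_d, f x <= f y.

(* Z has derivative v at t relative to the time interval [0, +oo[: one-sided at
   t = 0, the usual derivative at t > 0. Values of Z at negative times play no
   role. *)
Definition has_time_derivative (R : realType) (d : nat) (Z : R -> 'rV[R]_d)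
    (t : R) (v : 'rV[R]_d) : Prop :=
  (fun s => (s - t)^-1 *: (Z s - Z t)) @ within [set s | 0 <= s] t^' --> v.

Definition ode_solution (R : realType) (d : nat)
    (F G : 'rV[R]_d -> 'rV[R]_d -> 'rV[R]_d) (X V : R -> 'rV[R]_d) : Prop :=
  forall t : R, 0 <= t ->
    has_time_derivative X t (F (X t) (V t)) /\
    has_time_derivative V t (G (X t) (V t)).

Definition lyapunov_stable (R : realType) (d : nat)
    (F G : 'rV[R]_d -> 'rV[R]_d -> 'rV[R]_d) (x v : 'rV[R]_d) : Prop :=
  forall eps : R, 0 < eps -> exists2 delta : R, 0 < delta &
    forall X V : R -> 'rV[R]_d, ode_solution F G X V ->
      enorm (row_mx (X 0 - x) (V 0 - v)) < delta ->
      forall t : R, 0 <= t -> enorm (row_mx (X t - x) (V t - v)) < eps.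

Definition globally_asymptotically_stable (R : realType) (d : nat)
    (F G : 'rV[R]_d -> 'rV[R]_d -> 'rV[R]_d) (x v : 'rV[R]_d) : Prop :=
  [/\ F x v = 0 /\ G x v = 0,
      lyapunov_stable F G x v &
      forall X V : R -> 'rV[R]_d, ode_solution F G X V ->
        (X t @[t --> +oo] --> x) /\ (V t @[t --> +oo] --> v)].

Definition fieldX (R : realType) (d : nat) (f : 'rV[R]_d -> R) (m n : R)
    (x v : 'rV[R]_d) : 'rV[R]_d :=
  - m *: gradient f x - n *: (x - v).

Definition fieldV (R : realType) (d : nat) (f : 'rV[R]_d -> R) (p q : R)
    (x v : 'rV[R]_d) : 'rV[R]_d :=
  - p *: gradient f x - q *: (v - x).

(* Main.v *)
Require Import Defs.
From HB Require Import structures.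
From mathcomp Require Import all_boot all_order all_algebra.
From mathcomp Require Import all_classical all_reals all_analysis.
From mathcomp Require Import ring lra.
Set Implicit Arguments.
Unset Strict Implicit.
Unset Printing Implicit Defensive.
Import Order.TTheory GRing.Theory Num.Theory.
Import numFieldNormedType.Exports.
Local Open Scope classical_set_scope.
Local Open Scope ring_scope.

(** Translate the equilibrium to the origin, write x and v for the translated
states, g for the gradient of f at the current point, and D for the excess
f - f xs. Everything rests on the energy

  E = D - (n - q) / (2 p) * |x|^2 + n / (2 p) * |v|^2,

which for n = q is exactly the energy of part (a). The hypotheses of (a) then
also give n <= 2 q and q <= p mu, so both parts are the single claim that
E' <= - n E along solutions whenever n <= 2 q <= 2 p mu.

Strong convexity enters through two inequalities, <g, x> >= D + mu/2 |x|^2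
([gradient_growth]) and D >= mu/2 |x|^2 ([quadratic_growth]). Expanding
- n E - E' gives a sum of nonnegative terms ([field_decay_ineq]):

  m (|g|^2 - (n - q)/p <g, x>) + n (<g, x> - D - mu/2 |x|^2)
    + n/(2p) (p mu - q) |x|^2 + n/(2p) (2q - n) |x - v|^2.

The first one is nonnegative because (n - q)/p <= mu and mu <g, x> <= |g|^2; the
latter follows from |g - mu x|^2 >= 0 and <g, x> >= mu |x|^2.

E itself need not control |x|: when n = 2 q = 2 p mu and D = mu/2 |x|^2,
the x-part of E vanishes identically. It always dominates n/(2p) |v|^2, however,
while the X-equation alone gives (|x|^2)' <= - n |x|^2 + n |v|^2. Hence
L = |x|^2 + (4p/n) E satisfies L' <= - (n/2) L and L >= |x|^2 + 2 |v|^2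
([strict_decay], [strict_ge]). Such an L yields stability and attraction
([lyapunov_gas]).

The passage from a differential inequality to exponential decay
([lyapunov_decay]) says that expR (c t) times the energy is nonincreasing on
[0, +oo[. Time derivatives are one-sided at 0, but monotonicity needs only
continuity there. *)

(** * Energy decay along solutions *)

(** The difference Z s - Z t is the difference quotient times s - t, so it tends
to 0; the same works at t = 0, where the quotient is only one-sided. *)
Lemma time_derivative_continuous (R : realType) (d : nat) (Z Z' : R -> 'rV[R]_d) :
  (forall t, 0 <= t -> has_time_derivative Z t (Z' t)) ->
  {within `[0, +oo[, continuous Z}.
Proof.
move=> dZ; apply/subspace_continuousP => t; rewrite /= in_itv/= andbT => t0.
have dZt := dZ _ t0.
have st : (fun s : R => s - t) @ within [set s | 0 <= s] t^' --> (0 : R).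
  rewrite -[X in _ --> X](subrr t).
  have idt : (id : R -> R) @ within [set s | 0 <= s] t^' --> t.
    by apply: cvg_within_filter; exact: nbhs_dnbhs.
  exact: (cvgB idt (cvg_cst t)).
have ZtB : (fun s => (s - t) *: ((s - t)^-1 *: (Z s - Z t))) @
    within [set s | 0 <= s] t^' --> (0 : 'rV[R]_d).
  by rewrite -(scale0r (Z' t)); exact: cvgZ st dZt.
have Zt : Z @ within [set s | 0 <= s] t^' --> Z t.
  rewrite -[X in _ --> X]add0r.
  apply: cvg_trans (cvgD ZtB (cvg_cst (Z t))).
  apply: near_eq_cvg; rewrite near_withinE.
  near=> s => _ /=.
  rewrite fctE scalerA divff ?scale1r ?subrK// subr_eq0.
  by near: s; exact: nbhs_dnbhs_neq.
move=> U UZt; move: (Zt _ UZt).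
rewrite /= !near_simpl !near_withinE !near_simpl => H.
have {}H : \forall s \near t, s != t -> 0 <= s -> U (Z s) by exact: H.
near=> s; rewrite /= in_itv/= andbT => s0.
have [->|st'] := eqVneq s t; first exact: nbhs_singleton.
by apply: (near H s).
Unshelve. all: by end_near. Qed.

Lemma time_derivative_is_derive (R : realType) (d : nat) (Z : R -> 'rV[R]_d)
    (t : R) (v : 'rV[R]_d) :
  0 < t -> has_time_derivative Z t v -> is_derive t 1 Z v.
Proof.
move=> t0 dZ.
have sh : (fun h : R => h + t) @ 0^' --> within [set s | 0 <= s] t^'.
  have sht : (fun h : R => h + t) @ (0 : R) --> t.
    by rewrite -[X in _ --> X]add0r; apply: cvgD; [exact: cvg_id|exact: cvg_cst].
  move=> U UU; have H : \forall s \near t, s != t -> 0 <= s -> U s by exact: UU.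
  have {}H : \forall h \near (0 : R), h + t != t -> 0 <= h + t -> U (h + t).
    exact: sht _ H.
  have H0 : \forall h \near (0 : R), 0 < h + t by exact: sht _ (lt_nbhsr t0).
  suff : \forall h \near (0 : R), h != 0 -> U (h + t) by [].
  near=> h => h0; apply: (near H h) => //.
    by rewrite -subr_eq0 addrK.
  by apply/ltW/(near H0 h).
have {}dZ : h^-1 *: ((Z \o shift t) (h *: (1 : R)) - Z t) @[h --> 0^'] --> v.
  apply: cvg_trans (cvg_comp _ _ sh dZ).
  by apply: near_eq_cvg; near=> h; rewrite /= addrK [h *: 1]mulr1.
by apply: DeriveDef; [apply/cvg_ex; exists v|exact: cvg_lim dZ].
Unshelve. all: by end_near. Qed.

Lemma derive_along (R : realType) (d : nat) (phi : 'rV[R]_d -> R)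
    (Z : R -> 'rV[R]_d) (t : R) (v : 'rV[R]_d) :
  differentiable phi (Z t) -> is_derive t 1 Z v ->
  is_derive t 1 (phi \o Z) ('D_v phi (Z t)).
Proof.
move=> dphi [/derivable1_diffP dZ Zv].
have dcomp : differentiable (phi \o Z) t by exact: differentiable_comp.
apply: DeriveDef; first exact/derivable1_diffP.
by rewrite deriveE// diff_comp// deriveE// -Zv deriveE.
Qed.

(** The energy is split as phi (X t) + psi (V t), so that only functions of a
single vector have to be differentiated. *)
Lemma lyapunov_decay (R : realType) (d : nat)
    (F G : 'rV[R]_d -> 'rV[R]_d -> 'rV[R]_d) (phi psi : 'rV[R]_d -> R) (c : R) :
  (forall x, differentiable phi x) -> (forall v, differentiable psi v) ->
  (forall x v, 'D_(F x v) phi x + 'D_(G x v) psi v <= - c * (phi x + psi v)) ->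
  forall X V, ode_solution F G X V -> forall t, 0 <= t ->
  phi (X t) + psi (V t) <= expR (- c * t) * (phi (X 0) + psi (V 0)).
Proof.
move=> dphi dpsi decr X V sol t t0.
pose E (s : R) := phi (X s) + psi (V s).
pose h (s : R) := expR (c * s) * E s.
have cE : {within `[0, +oo[, continuous E}.
  have /subspace_continuousP cX :=
    time_derivative_continuous (fun s s0 => (sol s s0).1).
  have /subspace_continuousP cV :=
    time_derivative_continuous (fun s s0 => (sol s s0).2).
  apply/subspace_continuousP => s s0; apply: cvgD.
    exact: (cvg_comp X phi (cX _ s0) (differentiable_continuous (dphi _))).
  exact: (cvg_comp V psi (cV _ s0) (differentiable_continuous (dpsi _))).
have dh (s : R) : 0 < s -> is_derive s 1 h (expR (c * s) *
    (c * E s + ('D_(F (X s) (V s)) phi (X s) + 'D_(G (X s) (V s)) psi (V s)))).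
  move=> s0; have [solX solV] := sol s (ltW s0).
  have dX := derive_along (dphi _) (time_derivative_is_derive s0 solX).
  have dV := derive_along (dpsi _) (time_derivative_is_derive s0 solV).
  have dE := is_deriveD dX dV.
  have de : is_derive s 1 (fun s => expR (c * s)) (c * expR (c * s)).
    by apply: is_derive_eq; rewrite /GRing.scale/= mulr1 mulrC.
  have -> : h = (fun s : R => expR (c * s)) * ((phi \o X) + (psi \o V)) by [].
  have dM := is_deriveM de dE; apply: (is_derive_eq dM); rewrite /GRing.scale/=.
  by rewrite /E fctE /=; ring.
have hle : h t <= h 0.
  apply: (@ler0_derive1_nincry _ h 0) => //.
  - by move=> s; rewrite in_itv/= andbT => /dh[].
  - move=> s; rewrite in_itv/= andbT derive1E => /dh[_ ->].
    rewrite mulr_ge0_le0 ?expR_ge0//; have := decr (X s) (V s); rewrite /E; lra.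
  - apply/subspace_continuousP => s s0; apply: cvgM.
      apply: cvg_within_filter.
      by apply: continuous_comp; [exact: mulrl_continuous|exact: continuous_expR].
    by move/subspace_continuousP : cE; exact.
move: hle; rewrite /h mulr0 expR0 mul1r => hle.
by rewrite mulNr expRN mulrC ler_pdivlMr ?expR_gt0// mulrC.
Qed.

(** * Euclidean inner product *)

Definition dot (R : realType) (d : nat) (u v : 'rV[R]_d) : R :=
  \sum_(i < d) u 0 i * v 0 i.

Lemma dotC (R : realType) (d : nat) (u v : 'rV[R]_d) : dot u v = dot v u.
Proof. by apply: eq_bigr => i _; rewrite mulrC. Qed.

Lemma dotDl (R : realType) (d : nat) (u v w : 'rV[R]_d) :
  dot (u + v) w = dot u w + dot v w.
Proof. by rewrite /dot -big_split; apply: eq_bigr => i _; rewrite mxE mulrDl. Qed.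

Lemma dotZl (R : realType) (d : nat) (a : R) (u w : 'rV[R]_d) :
  dot (a *: u) w = a * dot u w.
Proof. by rewrite /dot mulr_sumr; apply: eq_bigr => i _; rewrite mxE mulrA. Qed.

Lemma dotNl (R : realType) (d : nat) (u w : 'rV[R]_d) : dot (- u) w = - dot u w.
Proof. by rewrite -scaleN1r dotZl mulN1r. Qed.

Lemma dotDr (R : realType) (d : nat) (u v w : 'rV[R]_d) :
  dot w (u + v) = dot w u + dot w v.
Proof. by rewrite dotC dotDl !(dotC _ w). Qed.

Lemma dotZr (R : realType) (d : nat) (a : R) (u w : 'rV[R]_d) :
  dot w (a *: u) = a * dot w u.
Proof. by rewrite dotC dotZl dotC. Qed.

Lemma dotNr (R : realType) (d : nat) (u w : 'rV[R]_d) : dot w (- u) = - dot w u.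
Proof. by rewrite dotC dotNl dotC. Qed.

Definition dotE := (dotDl, dotDr, dotNl, dotNr, dotZl, dotZr).

Lemma dot_ge0 (R : realType) (d : nat) (u : 'rV[R]_d) : 0 <= dot u u.
Proof. by apply: sumr_ge0 => i _; rewrite -expr2 sqr_ge0. Qed.

Lemma dot_eq0 (R : realType) (d : nat) (u : 'rV[R]_d) : dot u u = 0 -> u = 0.
Proof.
move=> /eqP; rewrite psumr_eq0; last by move=> i _; rewrite -expr2 sqr_ge0.
move=> /allP u0; apply/rowP => i; rewrite mxE; apply/eqP.
by rewrite -sqrf_eq0 expr2; apply: u0; rewrite mem_index_enum.
Qed.

Lemma enorm_sq (R : realType) (d : nat) (u : 'rV[R]_d) : enorm u ^+ 2 = dot u u.
Proof.
rewrite sqr_sqrtr; last by apply: sumr_ge0 => i _; exact: sqr_ge0.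
by apply: eq_bigr => i _; rewrite expr2.
Qed.

Lemma enorm_row_mx_sq (R : realType) (d e : nat) (u : 'rV[R]_d) (v : 'rV[R]_e) :
  enorm (row_mx u v) ^+ 2 = dot u u + dot v v.
Proof.
rewrite enorm_sq /dot big_split_ord /=.
by congr (_ + _); apply: eq_bigr => i _; rewrite ?row_mxEl ?row_mxEr.
Qed.

(** Convergence and neighbourhoods refer to the max norm; this comparison is what
carries Euclidean estimates over to them. *)
Lemma mx_norm_sq_le_dot (R : realType) (d : nat) (u : 'rV[R]_d) :
  `|u| ^+ 2 <= dot u u.
Proof.
rewrite /Num.norm/= -enorm_sq ler_sqr ?nnegrE ?sqrtr_ge0//; last first.
  by rewrite mx_normE.
rewrite mx_normrE; apply: bigmax_le => [|[i j] _ /=]; first exact: sqrtr_ge0.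
rewrite ord1 -sqrtr_sqr ler_sqrt; last by apply: sumr_ge0 => k _; exact: sqr_ge0.
by rewrite (bigD1 j)//= lerDl sumr_ge0// => k _; exact: sqr_ge0.
Qed.

(** * Directional derivatives *)

Lemma derive_gradient (R : realType) (d : nat) (f : 'rV[R]_d -> R)
    (x v : 'rV[R]_d) :
  differentiable f x -> 'D_v f x = dot (gradient f x) v.
Proof.
move=> df; rewrite deriveE// {1}[v]row_sum_delta linear_sum.
by apply: eq_bigr => i _; rewrite linearZ /= mxE deriveE// mulrC.
Qed.

Definition sqdist (R : realType) (d : nat) (c u : 'rV[R]_d) : R :=
  dot (u - c) (u - c).

Lemma is_derive_coord (R : realType) (d : nat) (x v : 'rV[R]_d) (i : 'I_d) :
  is_derive x v (fun u : 'rV[R]_d => u 0 i) (v 0 i).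
Proof.
apply: DeriveDef; first exact/diff_derivable/differentiable_coord.
apply: lim_near_cst => //; near=> h => /=.
rewrite !mxE addrK /GRing.scale/= mulrA mulVf ?mul1r//.
by near: h; exact: nbhs_dnbhs_neq.
Unshelve. all: by end_near. Qed.

Lemma sqdist_sumE (R : realType) (d : nat) (c : 'rV[R]_d) :
  sqdist c = \sum_(i < d) ((fun u : 'rV[R]_d => u 0 i) - cst (c 0 i)) ^+ 2.
Proof.
apply/funext => u; rewrite fct_sumE; apply: eq_bigr => i _.
by rewrite !mxE expr2.
Qed.

Lemma differentiable_sqdist (R : realType) (d : nat) (c x : 'rV[R]_d) :
  differentiable (sqdist c) x.
Proof.
rewrite sqdist_sumE; apply: differentiable_sum => i; apply: differentiableX.
by apply: differentiableB => //; exact: differentiable_coord.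
Qed.

Lemma derive_sqdist (R : realType) (d : nat) (c x v : 'rV[R]_d) :
  'D_v (sqdist c) x = 2 * dot (x - c) v.
Proof.
have dxi i := is_derive_coord x v i.
rewrite sqdist_sumE.
have [_ dsum] := is_derive_sum
  (fun i => is_deriveX 2 (is_deriveB (dxi i) (is_derive_cst (c 0 i) x v))).
apply: (etrans dsum).
rewrite /dot mulr_sumr; apply: eq_bigr => i _.
by rewrite !mxE subr0 expr1 /GRing.scale/= fctE mulrA.
Qed.

(** Convexity and minimality bound difference quotients for positive increments
only, hence the one-sided form. *)
Lemma derive_cvg_right (R : realType) (d : nat) (f : 'rV[R]_d -> R)
    (x v : 'rV[R]_d) : differentiable f x ->
  h^-1 * (f (x + h *: v) - f x) @[h --> 0^'+] --> 'D_v f x.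
Proof.
move=> df; have := cvg_dnbhs_at_right (diff_derivable (v := v) df).
apply: cvg_trans; apply: near_eq_cvg; near=> h.
by rewrite /= [x + _]addrC.
Unshelve. all: by end_near. Qed.

(** * First-order consequences of strong convexity *)

(** Divide the strong convexity inequality at x + h (y - x) by h and let h tend
to 0 from the right. *)
Lemma strongly_convex_gradient (R : realType) (d : nat) (mu : R)
    (f : 'rV[R]_d -> R) (x y : 'rV[R]_d) :
  differentiable f x -> strongly_convex mu f ->
  f x + dot (gradient f x) (y - x) + mu / 2 * dot (y - x) (y - x) <= f y.
Proof.
move=> df sc; pose D := mu / 2 * dot (y - x) (y - x).
suff : 'D_(y - x) f x <= f y - f x - D * (1 - 0).
  by rewrite derive_gradient// /D; lra.
have cr : (fun h : R => f y - f x - D * (1 - h)) @ 0^'+ --> f y - f x - D * (1 - 0).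
  apply: cvg_at_right_filter; apply: cvgB; first exact: cvg_cst.
  apply: cvgM; first exact: cvg_cst.
  by apply: cvgB; [exact: cvg_cst|exact: cvg_id].
apply: (ler_cvg_to (derive_cvg_right df) cr).
near=> h.
have h0 : 0 < h by [].
have h1 : h <= 1 by near: h; exact: nbhs_right_le.
rewrite ler_pdivrMl//.
have := sc y x h (ltW h0) h1; rewrite enorm_sq.
have -> : h *: y + (1 - h) *: x = x + h *: (y - x).
  by rewrite scalerBl scale1r scalerBr addrCA addrA.
rewrite /D; lra.
Unshelve. all: by end_near. Qed.

(** The derivative at a minimizer in the direction of the opposite gradient is
- |grad|^2, and it is a limit of nonnegative quotients. *)
Lemma gradient_minimizer (R : realType) (d : nat) (f : 'rV[R]_d -> R)
    (x : 'rV[R]_d) :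
  differentiable f x -> minimizer f x -> gradient f x = 0.
Proof.
move=> df xmin; apply: dot_eq0; apply/eqP; rewrite eq_le dot_ge0 andbT.
suff : 0 <= 'D_(- gradient f x) f x by rewrite derive_gradient// dotNr oppr_ge0.
apply: (cvgr_to_ge (derive_cvg_right df)); near=> h.
by rewrite mulr_ge0 ?subr_ge0// invr_ge0; apply: ltW.
Unshelve. all: by end_near. Qed.

(** * From a strict Lyapunov function to global asymptotic stability *)

Lemma lt_near_dot_ball (R : realType) (d : nat) (phi : 'rV[R]_d -> R)
    (a : 'rV[R]_d) (e : R) : differentiable phi a -> 0 < e ->
  exists2 r : R, 0 < r & forall x, dot (x - a) (x - a) < r ^+ 2 ->
    phi x < phi a + e.
Proof.
move=> dphi e0.
have cphi : phi @ a --> phi a by exact: differentiable_continuous.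
have : \forall x \near a, phi x < phi a + e.
  by apply: (cvgr_lt _ cphi); rewrite ltrDl.
move=> /nbhs_normP[r r0 ar]; exists r => // x xa; apply: ar => /=.
rewrite distrC -ltr_sqr ?nnegrE ?normr_ge0 ?(ltW r0)//.
exact: le_lt_trans (mx_norm_sq_le_dot _) xa.
Qed.

Lemma cvg_of_dot_le (R : realType) (d : nat) (Z : R -> 'rV[R]_d) (a : 'rV[R]_d)
    (b : R -> R) :
  (forall t, 0 <= t -> dot (Z t - a) (Z t - a) <= b t) ->
  b t @[t --> +oo] --> 0 -> Z t @[t --> +oo] --> a.
Proof.
move=> Zb b0; apply/cvgrPdist_lt => e e0.
have e20 : 0 < e ^+ 2 by rewrite exprn_gt0.
near=> t; rewrite distrC -ltr_sqr ?nnegrE ?normr_ge0 ?(ltW e0)//.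
apply: le_lt_trans (mx_norm_sq_le_dot _) _.
apply: (@le_lt_trans _ _ (b t)).
  by apply: Zb; near: t; exact: nbhs_pinfty_ge.
by near: t; exact: (cvgr_lt _ b0).
Unshelve. all: by end_near. Qed.

(** The squared distance to equilibrium is at most expR (- c t) times the initial
energy. The exponential factor gives attraction; bounding it by 1 and using
continuity of the energy at the equilibrium gives stability. *)
Lemma lyapunov_gas (R : realType) (d : nat)
    (F G : 'rV[R]_d -> 'rV[R]_d -> 'rV[R]_d) (a b : 'rV[R]_d)
    (phi psi : 'rV[R]_d -> R) (c : R) :
  0 < c -> F a b = 0 -> G a b = 0 ->
  (forall x, differentiable phi x) -> (forall v, differentiable psi v) ->
  (forall x v, 'D_(F x v) phi x + 'D_(G x v) psi v <= - c * (phi x + psi v)) ->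
  (forall x v, dot (x - a) (x - a) + dot (v - b) (v - b) <= phi x + psi v) ->
  phi a + psi b = 0 ->
  globally_asymptotically_stable F G a b.
Proof.
move=> c0 Fab Gab dphi dpsi decr coer W0.
have decay X V : ode_solution F G X V -> forall t, 0 <= t ->
    dot (X t - a) (X t - a) + dot (V t - b) (V t - b) <=
    expR (- c * t) * (phi (X 0) + psi (V 0)).
  move=> sol t t0; apply: le_trans (coer _ _) _.
  exact: lyapunov_decay dphi dpsi decr X V sol t t0.
split=> //.
- move=> e e0; have e20 : 0 < e ^+ 2 / 2 by rewrite divr_gt0// exprn_gt0.
  have [r1 r10 hr1] := lt_near_dot_ball (dphi a) e20.
  have [r2 r20 hr2] := lt_near_dot_ball (dpsi b) e20.
  exists (Num.min r1 r2); first by rewrite lt_min r10.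
  move=> X V sol; set z0 := enorm _ => z0lt t t0.
  have z0_ge0 : 0 <= z0 by exact: sqrtr_ge0.
  have z0r r : 0 < r -> z0 < r ->
      dot (X 0 - a) (X 0 - a) < r ^+ 2 /\ dot (V 0 - b) (V 0 - b) < r ^+ 2.
    move=> r0 z0r; have : z0 ^+ 2 < r ^+ 2.
      by rewrite ltr_sqr ?nnegrE// ltW.
    by rewrite /z0 enorm_row_mx_sq; have := dot_ge0 (X 0 - a); have := dot_ge0 (V 0 - b); lra.
  move: z0lt; rewrite lt_min => /andP[/(z0r _ r10)[/hr1 phi0 _]].
  move=> /(z0r _ r20)[_ /hr2 psi0].
  rewrite -ltr_sqr ?nnegrE ?sqrtr_ge0 ?ltW// enorm_row_mx_sq.
  apply: le_lt_trans (decay _ _ sol _ t0) _.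
  (* The factor expR (- c * t) is at most 1. *)
  apply: (@le_lt_trans _ _ (phi (X 0) + psi (V 0))); last by lra.
  rewrite ler_piMl//; last by rewrite -expR0 ler_expR mulNr oppr_le0 mulr_ge0// ltW.
  by apply: le_trans (coer _ _); rewrite addr_ge0 ?dot_ge0.
- move=> X V sol.
  have b0 : expR (- c * t) * (phi (X 0) + psi (V 0)) @[t --> +oo] --> 0.
    rewrite -[X in _ --> X](mul0r (phi (X 0) + psi (V 0))).
    apply: cvgM; last exact: cvg_cst.
    under eq_fun do rewrite mulNr.
    apply: (cvg_comp (fun t => c * t) (fun t => expR (- t))); last exact: cvgr_expR.
    by apply: gt0_cvgMry => //; exact: cvg_id.
  split; apply: (cvg_of_dot_le _ b0) => t t0; apply: le_trans (decay _ _ sol _ t0).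
    by rewrite lerDl dot_ge0.
  by rewrite lerDr dot_ge0.
Qed.

(** * Energies of the system *)

(** The decay of the energy as an inequality between scalars: D stands for
f x - f xs, and the doubled letters for the inner products of g, x and v. The
hypotheses 0 <= xx - 2 * xv + vv and 0 <= gg - 2 * mu * gx + mu ^+ 2 * xx are
|x - v|^2 >= 0 and |g - mu x|^2 >= 0. *)
Lemma field_decay_ineq (R : realFieldType) (mu m n p q D xx xv vv gx gv gg : R) :
  0 <= m -> 0 < n -> 0 < p -> 0 <= q ->
  n <= 2 * q -> q <= p * mu ->
  0 <= mu -> 0 <= xx -> 0 <= xx - 2 * xv + vv -> D + mu / 2 * xx <= gx ->
  mu / 2 * xx <= D -> 0 <= gg - 2 * mu * gx + mu ^+ 2 * xx ->
  - m * gg - n * (gx - gv) - (n - q) / p * (- m * gx - n * (xx - xv))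
    + n / p * (- p * gv - q * (vv - xv))
  <= - n * (D - (n - q) / (2 * p) * xx + n / (2 * p) * vv).
Proof.
move=> m0 n0 p0 q0 n2q qpmu mu0 xx0 xv2 Dgx xxD gg0.
have gx_mu : mu * xx <= gx by lra.
have gx0 : 0 <= gx by apply: le_trans gx_mu; rewrite mulr_ge0.
have gg_mu : mu * gx <= gg.
  by have := ler_wpM2l mu0 gx_mu; rewrite mulrA -expr2; lra.
have slope : (n - q) / p * gx <= gg.
  apply: le_trans gg_mu; apply: ler_wpM2r => //.
  by rewrite ler_pdivrMr//; lra.
rewrite -subr_ge0.
have -> : - n * (D - (n - q) / (2 * p) * xx + n / (2 * p) * vv)
   - (- m * gg - n * (gx - gv) - (n - q) / p * (- m * gx - n * (xx - xv))
    + n / p * (- p * gv - q * (vv - xv)))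
  = m * (gg - (n - q) / p * gx) + n * (gx - (D + mu / 2 * xx))
    + n / (2 * p) * (p * mu - q) * xx
    + n / (2 * p) * (2 * q - n) * (xx - 2 * xv + vv).
  by field; rewrite gt_eqF.
have np : 0 <= n / (2 * p) by rewrite divr_ge0 ?mulr_ge0// ltW.
apply: addr_ge0; [apply: addr_ge0; [apply: addr_ge0|]|].
- by rewrite mulr_ge0// subr_ge0.
- by rewrite mulr_ge0 ?subr_ge0// ltW.
- by rewrite mulr_ge0// mulr_ge0// subr_ge0.
- by rewrite mulr_ge0// mulr_ge0// subr_ge0.
Qed.

Section Energy.
Context (R : realType) (d : nat) (f : 'rV[R]_d -> R) (mu : R) (xs : 'rV[R]_d).
Context (m n p q : R).
Hypothesis mu_gt0 : 0 < mu.
Hypothesis f_diff : forall x : 'rV[R]_d, differentiable f x.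
Hypothesis f_sc : strongly_convex mu f.
Hypothesis xs_min : minimizer f xs.
Hypothesis m_ge0 : 0 <= m.
Hypothesis q_ge0 : 0 <= q.
Hypothesis n_gt0 : 0 < n.
Hypothesis p_gt0 : 0 < p.
Hypothesis n_le : n <= 2 * q.
Hypothesis q_le : q <= p * mu.

Definition energyX (x : 'rV[R]_d) : R :=
  f x - f xs - (n - q) / (2 * p) * sqdist xs x.

Definition energyV (v : 'rV[R]_d) : R := n / (2 * p) * sqdist xs v.

Lemma is_derive_energyX x w : is_derive x w energyX
  (dot (gradient f x) w - (n - q) / p * dot (x - xs) w).
Proof.
have df := derivableP (diff_derivable (v := w) (f_diff x)).
have ds := derivableP (diff_derivable (v := w) (differentiable_sqdist xs x)).
have dE := is_deriveB (is_deriveB df (is_derive_cst (f xs) x w))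
  (is_deriveZ ((n - q) / (2 * p)) ds).
apply: (is_derive_eq dE).
rewrite subr0 derive_gradient// derive_sqdist /GRing.scale/=.
by field; rewrite gt_eqF.
Qed.

Lemma is_derive_energyV v w : is_derive v w energyV (n / p * dot (v - xs) w).
Proof.
have ds := derivableP (diff_derivable (v := w) (differentiable_sqdist xs v)).
apply: (is_derive_eq (is_deriveZ (n / (2 * p)) ds)).
by rewrite derive_sqdist /GRing.scale/=; field; rewrite gt_eqF.
Qed.

Lemma differentiable_energyX x : differentiable energyX x.
Proof.
apply: differentiableB; first exact: differentiableB.
by apply: differentiableZ; exact: differentiable_sqdist.
Qed.

Lemma differentiable_energyV v : differentiable energyV v.
Proof. by apply: differentiableZ; exact: differentiable_sqdist. Qed.

Let grad_xs : gradient f xs = 0 := gradient_minimizer (f_diff xs) xs_min.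

Lemma quadratic_growth x : mu / 2 * sqdist xs x <= f x - f xs.
Proof.
have := strongly_convex_gradient x (f_diff xs) f_sc.
by rewrite grad_xs -[X in dot X](scale0r 0) dotZl mul0r /sqdist; lra.
Qed.

Lemma gradient_growth x :
  f x - f xs + mu / 2 * sqdist xs x <= dot (gradient f x) (x - xs).
Proof.
have := strongly_convex_gradient xs (f_diff x) f_sc.
by rewrite -(opprB x xs) !dotNr dotNl opprK -/(sqdist xs x); lra.
Qed.

Lemma energy_decay x v :
  'D_(fieldX f m n x v) energyX x + 'D_(fieldV f p q x v) energyV v
  <= - n * (energyX x + energyV v).
Proof.
have [_ ->] := is_derive_energyX x (fieldX f m n x v).
have [_ ->] := is_derive_energyV v (fieldV f p q x v).
have xvE : x - v = (x - xs) - (v - xs) by rewrite opprB addrA subrK.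
have := gradient_growth x; have := quadratic_growth x.
rewrite /energyX /energyV /fieldX /fieldV -(opprB x v) xvE /sqdist.
set g := gradient f x; set y := x - xs; set w := v - xs => growth ggrowth.
clearbody g y w.
have yw := dot_ge0 (y - w); have gy := dot_ge0 (g - mu *: y).
have mu0 := ltW mu_gt0.
have := @field_decay_ineq _ mu m n p q (f x - f xs) (dot y y) (dot y w) (dot w w)
  (dot g y) (dot g w) (dot g g) m_ge0 n_gt0 p_gt0 q_ge0 n_le q_le mu0 (dot_ge0 y)
  _ ggrowth growth _.
rewrite !dotE (dotC w y) (dotC y g) (dotC w g).
move: yw gy; rewrite !dotE (dotC w y) (dotC y g) => yw gy H.
apply: le_trans (H _ _); [|lra|lra].
rewrite le_eqVlt; apply/orP; left; apply/eqP; ring.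
Qed.

(** (n - q) / (2 p) <= mu / 2, so quadratic growth makes the x-part of the energy
nonnegative. *)
Lemma energy_ge x v : n / (2 * p) * sqdist xs v <= energyX x + energyV v.
Proof.
rewrite /energyV lerDr /energyX subr_ge0.
apply: le_trans (quadratic_growth x); apply: ler_wpM2r; first exact: dot_ge0.
by have := n_le; have := q_le; rewrite ler_pdivrMr ?mulr_gt0//; lra.
Qed.

(** The weight 4 p / n is twice what is needed to absorb the term n |v|^2 in
(|x|^2)' <= - n |x|^2 + n |v|^2: half of the decay of the energy pays for it and
the other half is left for [strict_decay]. *)
Definition strictX (x : 'rV[R]_d) : R := sqdist xs x + 4 * p / n * energyX x.

Definition strictV (v : 'rV[R]_d) : R := 4 * p / n * energyV v.

Lemma strict_decay x v :
  'D_(fieldX f m n x v) strictX x + 'D_(fieldV f p q x v) strictV v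
  <= - (n / 2) * (strictX x + strictV v).
Proof.
set F := fieldX f m n x v; set G := fieldV f p q x v.
have dX : 'D_F strictX x = 2 * dot (x - xs) F + 4 * p / n * 'D_F energyX x.
  have d1 := derivableP (diff_derivable (v := F) (differentiable_sqdist xs x)).
  have d2 := derivableP (diff_derivable (v := F) (differentiable_energyX x)).
  have [_ d3] := is_deriveD d1 (is_deriveZ (4 * p / n) d2).
  by apply: (etrans d3); rewrite derive_sqdist.
have dV : 'D_G strictV v = 4 * p / n * 'D_G energyV v.
  have d2 := derivableP (diff_derivable (v := G) (differentiable_energyV v)).
  by have [_ d3] := is_deriveZ (4 * p / n) d2; apply: (etrans d3).
have pn : 0 <= 4 * p / n by rewrite divr_ge0 ?mulr_ge0// ltW.
have := ler_wpM2l pn (energy_decay x v); rewrite -/F -/G.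
have -> : 4 * p / n * (- n * (energyX x + energyV v)) =
    - (4 * p * (energyX x + energyV v)) by field; rewrite gt_eqF.
have vE : n * sqdist xs v <= 2 * p * (energyX x + energyV v).
  have := ler_wpM2l (ltW p_gt0) (energy_ge x v).
  have -> : p * (n / (2 * p) * sqdist xs v) = n * sqdist xs v / 2.
    by field; rewrite gt_eqF.
  by lra.
(* The X-equation alone; the gradient only helps since <g, x> >= 0. *)
have drift : 2 * dot (x - xs) F <= - n * sqdist xs x + n * sqdist xs v.
  have xvE : x - v = (x - xs) - (v - xs) by rewrite opprB addrA subrK.
  have gx : 0 <= dot (gradient f x) (x - xs).
    apply: le_trans (gradient_growth x).
    rewrite addr_ge0 ?subr_ge0//.
    by rewrite mulr_ge0 ?dot_ge0// divr_ge0// ltW.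
  have xv : 0 <= n * dot (x - v) (x - v) by rewrite mulr_ge0 ?dot_ge0// ltW.
  move: (mulr_ge0 m_ge0 gx) xv; rewrite /F /fieldX /sqdist xvE.
  set g := gradient f x; set y := x - xs; set w := v - xs; clearbody g y w.
  by rewrite !dotE (dotC w y) (dotC y g); lra.
rewrite dX dV /strictX /strictV mulNr.
have -> : n / 2 * (sqdist xs x + 4 * p / n * energyX x + 4 * p / n * energyV v)
  = n / 2 * sqdist xs x + 2 * p * (energyX x + energyV v).
  by field; rewrite gt_eqF.
have : 0 <= n * sqdist xs x by rewrite mulr_ge0 ?dot_ge0// ltW.
by rewrite mulrDr; lra.
Qed.

Lemma strict_ge x v :
  dot (x - xs) (x - xs) + dot (v - xs) (v - xs) <= strictX x + strictV v.
Proof.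
have pn : 0 <= 4 * p / n by rewrite divr_ge0 ?mulr_ge0// ltW.
have := ler_wpM2l pn (energy_ge x v).
have -> : 4 * p / n * (n / (2 * p) * sqdist xs v) = 2 * sqdist xs v.
  by field; rewrite !gt_eqF.
have := dot_ge0 (v - xs); rewrite /strictX /strictV /sqdist mulrDr; lra.
Qed.

Lemma flow_gas :
  globally_asymptotically_stable (fieldX f m n) (fieldV f p q) xs xs.
Proof.
apply: (@lyapunov_gas _ _ _ _ _ _ strictX strictV (n / 2)).
- by rewrite divr_gt0.
- by rewrite /fieldX grad_xs subrr !scaler0 subrr.
- by rewrite /fieldV grad_xs subrr !scaler0 subrr.
- move=> x; apply: differentiableD; first exact: differentiable_sqdist.
  by apply: differentiableZ; exact: differentiable_energyX.
- by move=> v; apply: differentiableZ; exact: differentiable_energyV.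
- exact: strict_decay.
- exact: strict_ge.
- rewrite /strictX /strictV /energyX /energyV /sqdist subrr.
  by rewrite -(scale0r 0) dotZl; ring.
Qed.

Lemma flow_energy_decay X V :
  ode_solution (fieldX f m n) (fieldV f p q) X V -> forall t, 0 <= t ->
  energyX (X t) + energyV (V t) <=
  expR (- n * t) * (energyX (X 0) + energyV (V 0)).
Proof.
exact: lyapunov_decay differentiable_energyX differentiable_energyV energy_decay X V.
Qed.

End Energy.

(** * Stability and convergence rates *)

Theorem theorem4 (R : realType) (d : nat) (f : 'rV[R]_d -> R) (mu : R)
    (xs : 'rV[R]_d) (m n p q : R)
    (mu_gt0 : 0 < mu)
    (f_diff : forall x : 'rV[R]_d, differentiable f x)
    (f_sc : strongly_convex mu f)
    (xs_min : minimizer f xs)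
    (m_ge0 : 0 <= m) (q_ge0 : 0 <= q) (n_gt0 : 0 < n) (p_gt0 : 0 < p) :
  (n = q -> q <= p * mu ->
    globally_asymptotically_stable (fieldX f m n) (fieldV f p q) xs xs /\
    forall X V : R -> 'rV[R]_d,
      ode_solution (fieldX f m n) (fieldV f p q) X V ->
      let eps (t : R) : R :=
        f (X t) - f xs + q / (2 * p) * enorm (V t - xs) ^+ 2 in
      (forall t : R, 0 <= t -> eps t <= expR (- q * t) * eps 0) /\
      (X t @[t --> +oo] --> xs) /\ (V t @[t --> +oo] --> xs)) /\
  (n <= 2 * q -> 2 * q <= 2 * p * mu -> m <= 2 * p ->
    globally_asymptotically_stable (fieldX f m n) (fieldV f p q) xs xs /\
    forall X V : R -> 'rV[R]_d,
      ode_solution (fieldX f m n) (fieldV f p q) X V ->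
      let eps (t : R) : R :=
        f (X t) - f xs - (n - q) / (2 * p) * enorm (X t - xs) ^+ 2
          + n / (2 * p) * enorm (V t - xs) ^+ 2 in
      (forall t : R, 0 <= t -> eps t <= expR (- n * t) * eps 0) /\
      (X t @[t --> +oo] --> xs) /\ (V t @[t --> +oo] --> xs)).
Proof.
have gas := flow_gas mu_gt0 f_diff f_sc xs_min m_ge0 q_ge0 n_gt0 p_gt0.
have decay :=
  flow_energy_decay mu_gt0 f_diff f_sc xs_min m_ge0 q_ge0 n_gt0 p_gt0.
split=> [nq qp|n2q qp _].
  have n2q : n <= 2 * q by lra.
  have qpm : q <= p * mu by [].
  have G := gas n2q qpm; split=> // X V sol eps; split; last first.
    by have [_ _] := G; apply.
  move=> t t0; have := decay n2q qpm X V sol t t0.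
  by rewrite /energyX /energyV /sqdist /eps !enorm_sq nq subrr !mul0r !subr0.
have qpm : q <= p * mu by rewrite -mulrA ler_pM2l in qp.
have G := gas n2q qpm; split=> // X V sol eps; split; last first.
  by have [_ _] := G; apply.
move=> t t0; have := decay n2q qpm X V sol t t0.
by rewrite /energyX /energyV /sqdist /eps !enorm_sq.
Qed.
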